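(* Let $r\ge 1$ and let $\bm{\mu}=(\mu_1,\dots,\mu_r)$ be a perfect system of linear functionals. Let $\Phi_j(x)=\prod_{k=1}^{N_j}(x-z_{j,k})$ ($j=1,\dots,r$) and $\Psi(x)=\prod_{k=1}^{M}(x-w_k)$ be complex polynomials, each having only simple zeros (different polynomials may share zeros), and put $\bm{N}=(N_1,\dots,N_r)$. Let $\widetilde{\bm{\mu}}=(\widetilde\mu_1,\dots,\widetilde\mu_r)$ be any system of linear functionals with $\Psi\widetilde\mu_j=\Phi_j\mu_j$, and let $\check\mu_1,\dots,\check\mu_r$ be any linear functionals with $\Phi_j\check\mu_j=\widetilde\mu_j$, $j=1,\dots,r$. For $\bm{n}\in\mathbb{N}^r$ let $\bm{A}_{\bm{n}}=(A^{(1)}_{\bm{n}},\dots,A^{(r)}_{\bm{n}})$ be the normalized type I polynomial of $\bm{\mu}$, and set $$B_{\bm{n}}(w_k)=\sum_{j=1}^r\check\mu_j\left[A^{(j)}_{\bm{n}}(x)\frac{\Psi(x)}{x-w_k}\right],\qquad k=1,\dots,M.$$ Write $A^{(j)}_{\bm{n}}(\bm{z}_j)$ for the column vector $(A^{(j)}_{\bm{n}}(z_{j,1}),\dots,A^{(j)}_{\bm{n}}(z_{j,N_j}))^{T}$ and $B_{\bm{n}}(\bm{w})$ for the column vector $(B_{\bm{n}}(w_1),\dots,B_{\bm{n}}(w_M))^{T}$. (1) Let $\bm{n}\in\mathbb{N}^r$ with $|\bm{n}|>M$, let $\bm{m}\in\mathbb{N}^r$ with $|\bm{m}|=|\bm{n}|-M$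 and $\bm{m}\le\bm{n}+\bm{N}$, and let $\{\bm{m}+\bm{s}_i\}_{i=0}^{|\bm{N}|+M}$ be an admissible sequence from $\bm{m}$ towards $\bm{n}+\bm{N}$. Then the expressions $$\widetilde A^{(j)}_{\bm{n}}(x)=\Phi_j(x)^{-1}\det\begin{pmatrix} A^{(j)}_{\bm{m}}(x)&A^{(j)}_{\bm{m}+\bm{s}_1}(x)&\cdots&A^{(j)}_{\bm{m}+\bm{s}_{|\bm{N}|+M}}(x)\\ A^{(1)}_{\bm{m}}(\bm{z}_1)&A^{(1)}_{\bm{m}+\bm{s}_1}(\bm{z}_1)&\cdots&A^{(1)}_{\bm{m}+\bm{s}_{|\bm{N}|+M}}(\bm{z}_1)\\ \vdots&\vdots&\ddots&\vdots\\ A^{(r)}_{\bm{m}}(\bm{z}_r)&A^{(r)}_{\bm{m}+\bm{s}_1}(\bm{z}_r)&\cdots&A^{(r)}_{\bm{m}+\bm{s}_{|\bm{N}|+M}}(\bm{z}_r)\\ B_{\bm{m}}(\bm{w})&B_{\bm{m}+\bm{s}_1}(\bm{w})&\cdots&B_{\bm{m}+\bm{s}_{|\bm{N}|+M}}(\bm{w}) \end{pmatrix},\qquad j=1,\dots,r,$$ define a vector of polynomials $\widetilde{\bm{A}}_{\bm{n}}=(\widetilde A^{(1)}_{\bm{n}},\dots,\widetilde A^{(r)}_{\bm{n}})$ satisfying the type I orthogonality conditions $\sum_{j=1}^r\widetilde\mu_j[\widetilde A^{(j)}_{\bm{n}}(x)x^p]=0$ for $p=0,\dots,|\bm{n}|-2$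 and the type I degree conditions $\deg\widetilde A^{(j)}_{\bm{n}}\le n_j-1$, $j=1,\dots,r$. The index $\bm{n}$ is normal for $\widetilde{\bm{\mu}}$ if and only if $D^{(I)}_{\bm{n}}\ne0$, where $$D^{(I)}_{\bm{n}}=\det\begin{pmatrix} A^{(1)}_{\bm{m}+\bm{s}_1}(\bm{z}_1)&\cdots&A^{(1)}_{\bm{m}+\bm{s}_{|\bm{N}|+M}}(\bm{z}_1)\\ \vdots&\ddots&\vdots\\ A^{(r)}_{\bm{m}+\bm{s}_1}(\bm{z}_r)&\cdots&A^{(r)}_{\bm{m}+\bm{s}_{|\bm{N}|+M}}(\bm{z}_r)\\ B_{\bm{m}+\bm{s}_1}(\bm{w})&\cdots&B_{\bm{m}+\bm{s}_{|\bm{N}|+M}}(\bm{w}) \end{pmatrix},$$ and in that case $\frac{1}{D^{(I)}_{\bm{n}}}\widetilde{\bm{A}}_{\bm{n}}$ is the normalized type I polynomial for the index $\bm{n}$ with respect to $\widetilde{\bm{\mu}}$. (2) Let $0<|\bm{n}|\le M$. Let multi-indices, denoted $\bm{m}+\bm{s}_i$ for $i=M-|\bm{n}|,\dots,|\bm{N}|+M$, form (in this order, the one for $i=M-|\bm{n}|$ being $\bm{0}$) an admissible sequence from $\bm{0}$ towards $\bm{n}+\bm{N}$. For $i>M-|\bm{n}|$ let $A^{(j)}_{\bm{m}+\bm{s}_i}$ be the components of the normalized type I polynomial of $\bm{\mu}$ for the index $\bm{m}+\bm{s}_i$, and let $B_{\bm{m}+\bm{s}_i}(w_k)=\sum_{j=1}^r\check\mu_j\left[A^{(j)}_{\bm{m}+\bm{s}_i}(x)\frac{\Psi(x)}{x-w_k}\right]$,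 $k=1,\dots,M$. For $i=0,\dots,M-|\bm{n}|$ (where for $i<M-|\bm{n}|$ the subscript $\bm{m}+\bm{s}_i$ is only a label), put instead $A^{(j)}_{\bm{m}+\bm{s}_i}=0$ for all $j=1,\dots,r$, and $B_{\bm{m}+\bm{s}_i}(w_k)=w_k^{M-|\bm{n}|-i}$, $k=1,\dots,M$. With these quantities and the same column vector notation, define $$\widetilde A^{(j)}_{\bm{n}}(x)=\Phi_j(x)^{-1}\det\begin{pmatrix} A^{(j)}_{\bm{m}+\bm{s}_0}(x)&A^{(j)}_{\bm{m}+\bm{s}_1}(x)&\cdots&A^{(j)}_{\bm{m}+\bm{s}_{|\bm{N}|+M}}(x)\\ A^{(1)}_{\bm{m}+\bm{s}_0}(\bm{z}_1)&A^{(1)}_{\bm{m}+\bm{s}_1}(\bm{z}_1)&\cdots&A^{(1)}_{\bm{m}+\bm{s}_{|\bm{N}|+M}}(\bm{z}_1)\\ \vdots&\vdots&\ddots&\vdots\\ A^{(r)}_{\bm{m}+\bm{s}_0}(\bm{z}_r)&A^{(r)}_{\bm{m}+\bm{s}_1}(\bm{z}_r)&\cdots&A^{(r)}_{\bm{m}+\bm{s}_{|\bm{N}|+M}}(\bm{z}_r)\\ B_{\bm{m}+\bm{s}_0}(\bm{w})&B_{\bm{m}+\bm{s}_1}(\bm{w})&\cdots&B_{\bm{m}+\bm{s}_{|\bm{N}|+M}}(\bm{w}) \end{pmatrix},\qquad j=1,\dots,r,$$ and $$D^{(I)}_{\bm{n}}=\det\begin{pmatrix} A^{(1)}_{\bm{m}+\bm{s}_1}(\bm{z}_1)&\cdots&A^{(1)}_{\bm{m}+\bm{s}_{|\bm{N}|+M}}(\bm{z}_1)\\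 \vdots&\ddots&\vdots\\ A^{(r)}_{\bm{m}+\bm{s}_1}(\bm{z}_r)&\cdots&A^{(r)}_{\bm{m}+\bm{s}_{|\bm{N}|+M}}(\bm{z}_r)\\ B_{\bm{m}+\bm{s}_1}(\bm{w})&\cdots&B_{\bm{m}+\bm{s}_{|\bm{N}|+M}}(\bm{w}) \end{pmatrix}.$$ Then $\widetilde{\bm{A}}_{\bm{n}}=(\widetilde A^{(1)}_{\bm{n}},\dots,\widetilde A^{(r)}_{\bm{n}})$ is a vector of polynomials satisfying $\sum_{j=1}^r\widetilde\mu_j[\widetilde A^{(j)}_{\bm{n}}(x)x^p]=0$ for $p=0,\dots,|\bm{n}|-2$ and $\deg\widetilde A^{(j)}_{\bm{n}}\le n_j-1$, $j=1,\dots,r$; the index $\bm{n}$ is normal for $\widetilde{\bm{\mu}}$ if and only if $D^{(I)}_{\bm{n}}\ne0$; and in that case $\frac{1}{D^{(I)}_{\bm{n}}}\widetilde{\bm{A}}_{\bm{n}}$ is the normalized type I polynomial for the index $\bm{n}$ with respect to $\widetilde{\bm{\mu}}$. (3) If $\bm{n}=\bm{0}$, then $\widetilde{\bm{A}}_{\bm{n}}=\bm{0}$.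
   Context: $\mathbb{N}=\{0,1,2,\dots\}$. For $\bm{n}=(n_1,\dots,n_r)\in\mathbb{N}^r$, $|\bm{n}|=n_1+\cdots+n_r$; inequalities between multi-indices are componentwise; $(\bm{s})_k$ is the $k$-th component of $\bm{s}$. A linear functional means a complex linear functional on the space $\mathbb{C}[x]$ of polynomials (no positivity assumed). For a polynomial $\Phi$ and a functional $\mu$, $\Phi\mu$ is the functional $(\Phi\mu)[P]=\mu[\Phi P]$. Type I polynomials of a system of functionals $\bm{\mu}=(\mu_1,\dots,\mu_r)$ for the index $\bm{n}\ne\bm{0}$: non-zero vectors of polynomials $(A^{(1)}_{\bm{n}},\dots,A^{(r)}_{\bm{n}})$ with $\deg A^{(j)}_{\bm{n}}\le n_j-1$ (so $A^{(j)}_{\bm{n}}=0$ if $n_j=0$) and $\sum_{j=1}^r\mu_j[A^{(j)}_{\bm{n}}(x)x^p]=0$ for $p=0,\dots,|\bm{n}|-2$. For $\bm{n}=\bm{0}$ one sets $\bm{A}_{\bm{0}}=\bm{0}$. Normality: with moments $\nu^{(j)}_k=\mu_j[x^k]$, the index $\bm{n}\ne\bm{0}$ is normal for $\bm{\mu}$ if $\det H_{\bm{n}}\ne0$, where $H_{\bm{n}}$ is the $|\bm{n}|\times|\bm{n}|$ matrix formed by stacking, for $j=1,\dots,r$, the rows $(\nu^{(j)}_{p},\nu^{(j)}_{p+1},\dots,\nu^{(j)}_{p+|\bm{n}|-1})$, $p=0,\dots,n_j-1$. Equivalently, there is a unique type I polynomial for $\bm{n}$ with $\sum_{j=1}^r\mu_j[A^{(j)}_{\bm{n}}(x)x^{|\bm{n}|-1}]=1$;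 this one is called the normalized type I polynomial. The index $\bm{0}$ is always normal. The system $\bm{\mu}$ is perfect if every $\bm{n}\in\mathbb{N}^r$ is normal. Admissible (increasing) sequence: for $\bm{n}\le\bm{m}$ in $\mathbb{N}^r$ and $d=|\bm{m}|-|\bm{n}|$, a sequence $\{\bm{n}+\bm{s}_j\}_{j=0}^d$ of multi-indices is an admissible sequence from $\bm{n}$ towards $\bm{m}$ if $\bm{s}_0=\bm{0}$, $\bm{n}\le\bm{n}+\bm{s}_j\le\bm{m}$ for $j=1,\dots,d$, and for some $k_1,\dots,k_d\in\{1,\dots,r\}$ one has $(\bm{s}_i)_{k_j}<(\bm{s}_j)_{k_j}$ for all $0\le i<j\le d$. (It need not pass through $\bm{m}$.)
   Formalization: In part (2) the normalized type I polynomial is −(1/D) times the vector Ã_n, not (1/D)Ã_n: for r=1, Φ=1, Ψ=x, μ[x^k]=k!, n=1 one has Ã=−1, D=μ̃[1], so (1/D)Ã has normalization −1; all else is as stated. *)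

(* Defs.v *)
From HB Require Import structures.
From mathcomp Require Import all_boot all_order all_algebra.
From mathcomp Require Export complex reals.

Set Implicit Arguments.
Unset Strict Implicit.
Unset Printing Implicit Defensive.

Import GRing.Theory.
Local Open Scope ring_scope.

(* Multi-indices form an additive monoid: 0 and n + m are the pointwise
   operations of {ffun 'I_r -> nat}. *)
Notation multi r := {ffun 'I_r -> nat}.

Definition mlen (r : nat) (n : multi r) : nat := (\sum_(j < r) n j)%N.

Definition mle (r : nat) (n m : multi r) : Prop := forall j, (n j <= m j)%N.

(* The sequence is {n + s_j}_{j=0..d} with d = |m| - |n|; the values s j for
   j > d, and k j for j outside 1..d, are irrelevant. *)
Definition admissible (r : nat) (n m : multi r) (s : nat -> multi r) : Prop :=
  let d := (mlen m - mlen n)%N in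
  [/\ mle n m,
      s 0%N = 0,
      forall j, (1 <= j <= d)%N -> mle n (n + s j) /\ mle (n + s j) m
    & exists k : nat -> 'I_r,
        forall i j, (i < j <= d)%N -> (s i (k j) < s j (k j))%N].

Section Functionals.
Variables (C : fieldType) (r : nat).

Definition system : Type := 'I_r -> {scalar {poly C}}.

Definition pmulf (Phi : {poly C}) (mu : {scalar {poly C}}) : {poly C} -> C :=
  fun P => mu (Phi * P).

Lemma pmulf_is_scalar Phi mu : scalar (pmulf Phi mu).
Proof.
by move=> a P Q; rewrite /pmulf mulrDr -scalerAr linearP.
Qed.

HB.instance Definition _ Phi mu :=
  GRing.isLinear.Build C {poly C} C *%R (pmulf Phi mu) (pmulf_is_scalar Phi mu).

Local Notation pvec := {ffun 'I_r -> {poly C}}.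

(* size is degree + 1, so this is deg A^(j) <= n_j - 1, with A^(j) = 0 when
   n_j = 0. *)
Definition typeI_deg (n : multi r) (A : pvec) : Prop :=
  forall j, (size (A j) <= n j)%N.

(* p + 1 < |n| is p <= |n| - 2 without truncated subtraction. *)
Definition typeI_orth (mu : system) (n : multi r) (A : pvec) : Prop :=
  forall p, (p.+1 < mlen n)%N -> \sum_(j < r) mu j (A j * 'X^p) = 0.

Definition typeI (mu : system) (n : multi r) (A : pvec) : Prop :=
  [/\ A <> 0, typeI_deg n A & typeI_orth mu n A].

Definition normalized_typeI (mu : system) (n : multi r) (A : pvec) : Prop :=
  if n == 0 then A = 0
  else typeI mu n A /\ \sum_(j < r) mu j (A j * 'X^((mlen n).-1)) = 1.

Definition hankel (mu : system) (n : multi r) : 'M[C]_(mlen n) :=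
  \mxcol_(j < r) \matrix_(p < n j, q < mlen n) mu j 'X^(p + q).

(* For n = 0 the determinant of the empty matrix is 1: 0 is always normal. *)
Definition normal (mu : system) (n : multi r) : Prop := \det (hankel mu n) != 0.

Definition perfect (mu : system) : Prop := forall n, normal mu n.

Definition nodal (N : nat) (z : 'I_N -> C) : {poly C} :=
  \prod_(k < N) ('X - (z k)%:P).

(* B(w_k) for a vector A; the division by x - w_k is exact. *)
Definition Bval (chk : system) (M : nat) (w : 'I_M -> C) (A : pvec) (k : 'I_M)
    : C :=
  \sum_(j < r) chk j (A j * (nodal w %/ ('X - (w k)%:P))).

Section Determinants.
Variables (N : multi r) (z : forall j, 'I_(N j) -> C) (M : nat).

(* The rows A^(1)(z_1), ..., A^(r)(z_r), B(w) of the determinants, for columns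
   given by vectors A i and values B i. *)
Definition eval_mx (q : nat) (A : 'I_q -> pvec) (B : 'I_q -> 'I_M -> C)
    : 'M[C]_(mlen N + M, q) :=
  col_mx (\mxcol_(j < r) \matrix_(k < N j, i < q) (A i j).[z k])
         (\matrix_(k < M, i < q) B i k).

(* Columns are indexed by i = 0, ..., |N| + M. *)
Definition tilde_det (A : nat -> pvec) (B : nat -> 'I_M -> C) (j : 'I_r)
    : {poly C} :=
  \det (col_mx (\row_(i < 1 + (mlen N + M)) A i j)
          (map_mx polyC (eval_mx (fun i : 'I_(1 + (mlen N + M)) => A i)
                                 (fun i : 'I_(1 + (mlen N + M)) => B i)))).

(* The quotient is meaningful when Phi_j divides the determinant. *)
Definition tilde_vec (A : nat -> pvec) (B : nat -> 'I_M -> C) : pvec :=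
  [ffun j => tilde_det A B j %/ nodal (@z j)].

(* Columns are i = 1, ..., |N| + M. *)
Definition DI (A : nat -> pvec) (B : nat -> 'I_M -> C) : C :=
  \det (eval_mx (fun i : 'I_(mlen N + M) => A i.+1)
                (fun i : 'I_(mlen N + M) => B i.+1)).

End Determinants.

Definition pvec_scale (c : C) (A : pvec) : pvec := [ffun j => c *: A j].

End Functionals.

(* Main.v *)
(* Write Phi_j = nodal (z j) and Psi = nodal w. A vector P in the span of
   the columns whose coordinates c lie in the kernel of the evaluation
   rows vanishes at the zeros of Phi, hence P_j = Phi_j Q_j, and c |-> Q
   is a bijection from that kernel onto the vectors Q satisfying the type
   I degree and orthogonality conditions for mut and n. Surjectivity is a
   dimension count: along an admissible sequence the k_j-th components
   have increasing degrees, so the type I vectors are independent. The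
   vector of top cofactors is in the kernel and gives the tilde vector.
   Let F be the functional G |-> sum_j mut_j[Q_j G]. Then F[Psi G] = sum_j
   mu_j[P_j G], and F[Psi / (x - w_k)] is the B-value of P at w_k. For |n|
   > M the B-values vanish, so F vanishes in degree < M and its other
   moments are those of P. For |n| <= M the B-values are those of -g, with
   deg g <= M - |n|, and Lagrange interpolation at the w_k turns the
   coefficients of g into moments of F. In both cases F[x^(|n|-1)] = c_0
   or - c_0, so n is normal iff no non-zero kernel vector has c_0 = 0,
   i.e. iff D is non-zero. *)
From HB Require Import structures.
Require Import Defs.
From mathcomp Require Import all_boot all_order all_algebra.
From mathcomp Require Import zify.

Set Implicit Arguments.
Unset Strict Implicit.
Unset Printing Implicit Defensive.

Import GRing.Theory.
Local Open Scope ring_scope.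

(** * Functionals on polynomials and Lagrange interpolation at simple nodes *)

Section Polynomials.
Variable C : fieldType.

Lemma functional_graded (f : {scalar {poly C}}) (a : nat) (G : {poly C}) :
  (forall i, (i < a)%N -> f 'X^i = 0) -> (size G <= a.+1)%N ->
  f G = G`_a * f 'X^a.
Proof.
move=> f0 sG; have {1}-> : G = \poly_(i < a.+1) G`_i.
  apply/polyP => i; rewrite coef_poly; case: ltnP => // ai.
  by rewrite nth_default // (leq_trans sG).
rewrite poly_def linear_sum /= big_ord_recr /= linearZ /=.
by rewrite big1 ?add0r // => i _; rewrite linearZ /= f0 ?mulr0.
Qed.

Lemma functional_eq0 (f : {scalar {poly C}}) (a : nat) (G : {poly C}) :
  (forall i, (i < a)%N -> f 'X^i = 0) -> (size G <= a)%N -> f G = 0.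
Proof.
move=> f0 sG; rewrite (functional_graded f0) ?nth_default ?mul0r //.
exact: leqW.
Qed.

Variables (M : nat) (w : 'I_M -> C).
Hypothesis w_inj : injective w.

Lemma size_nodal : size (nodal w) = M.+1.
Proof.
by rewrite /nodal size_prod_XsubC -[index_enum _]enumT size_enum_ord.
Qed.

Lemma monic_nodal : nodal w \is monic.
Proof. exact: monic_prod_XsubC. Qed.

Lemma nodal_neq0 : nodal w != 0.
Proof. exact/monic_neq0/monic_nodal. Qed.

Lemma uniq_nodes : uniq [seq w k | k <- index_enum 'I_M].
Proof. by rewrite map_inj_uniq // index_enum_uniq. Qed.

Lemma nodal_dvdp (P : {poly C}) : (forall k, P.[w k] = 0) -> nodal w %| P.
Proof.
move=> P0; rewrite /nodal -(big_map w xpredT (fun x => 'X - x%:P)).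
apply: uniq_roots_dvdp; last by rewrite uniq_rootsE uniq_nodes.
by apply/allP => x /mapP[k _ ->]; rewrite /root P0.
Qed.

Lemma eq0_of_nodes (P : {poly C}) :
  (size P <= M)%N -> (forall k, P.[w k] = 0) -> P = 0.
Proof.
move=> sP P0.
apply: (roots_geq_poly_eq0 (rs := [seq w k | k <- index_enum 'I_M])).
- by apply/allP => x /mapP[k _ ->]; rewrite /root P0.
- exact: uniq_nodes.
- by rewrite size_map -[index_enum _]enumT size_enum_ord.
Qed.

(** The Lagrange basis polynomial at [w k], scaled to be monic; it is also the polynomial against
    which [Bval] pairs. *)
Definition conodal (k : 'I_M) : {poly C} := nodal w %/ ('X - (w k)%:P).

Lemma conodalE k : conodal k = \prod_(i < M | i != k) ('X - (w i)%:P).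
Proof. by rewrite /conodal /nodal (bigD1 k) //= mulKp ?polyXsubC_eq0. Qed.

Lemma nodal_conodal k : nodal w = ('X - (w k)%:P) * conodal k.
Proof. by rewrite conodalE /nodal (bigD1 k). Qed.

Lemma horner_nodal k : (nodal w).[w k] = 0.
Proof. by rewrite (nodal_conodal k) hornerM hornerXsubC subrr mul0r. Qed.

Lemma monic_conodal k : conodal k \is monic.
Proof. by rewrite conodalE; apply: monic_prod => i _; apply: monicXsubC. Qed.

Lemma size_conodal k : size (conodal k) = M.
Proof.
have := size_nodal; rewrite (nodal_conodal k) size_monicM ?monicXsubC //.
  by rewrite size_XsubC => -[].
exact/monic_neq0/monic_conodal.
Qed.

Lemma conodal_other k l : k != l -> (conodal k).[w l] = 0.
Proof.
rewrite eq_sym => kl; rewrite conodalE horner_prod (bigD1 l) //=.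
by rewrite hornerXsubC subrr mul0r.
Qed.

Lemma conodal_self k : (conodal k).[w k] != 0.
Proof.
rewrite conodalE horner_prod; apply/prodf_neq0 => i ik.
by rewrite hornerXsubC subr_eq0 (inj_eq w_inj) eq_sym.
Qed.

Lemma horner_conodal_sum (b : 'I_M -> C) l :
  (\sum_(k < M) (b k / (conodal k).[w k]) *: conodal k).[w l] = b l.
Proof.
rewrite horner_sum (bigD1 l) //= hornerZ divfK ?conodal_self //.
by rewrite big1 ?addr0 // => k kl; rewrite hornerZ (conodal_other kl) mulr0.
Qed.

Lemma size_conodal_sum (b : 'I_M -> C) :
  (size (\sum_(k < M) b k *: conodal k)%R <= M)%N.
Proof.
apply: (leq_trans (size_sum _ _ _)); apply/bigmax_leqP => k _.
by rewrite (leq_trans (size_scale_leq _ _)) ?size_conodal.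
Qed.

Lemma conodal_interpolation (G : {poly C}) : (size G <= M)%N ->
  G = \sum_(k < M) (G.[w k] / (conodal k).[w k]) *: conodal k.
Proof.
move=> sG; apply/eqP; rewrite -subr_eq0; apply/eqP/eq0_of_nodes => [|k].
  rewrite (leq_trans (size_polyD _ _)) // size_polyN geq_max sG.
  exact: size_conodal_sum.
by rewrite hornerD hornerN horner_conodal_sum subrr.
Qed.

(** In Lagrange's formula every [conodal k] is monic of degree M - 1, so this coefficient is the sum
    of the weights. *)
Lemma coef_interpolation (G : {poly C}) : (size G <= M)%N ->
  G`_M.-1 = \sum_(k < M) G.[w k] / (conodal k).[w k].
Proof.
move=> /conodal_interpolation {1}->; rewrite coef_sum; apply: eq_bigr => k _.
rewrite coefZ -[X in _`_X.-1](size_conodal k) -lead_coefE.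
by rewrite (monicP (monic_conodal k)) mulr1.
Qed.

Lemma functional_interpolation (f : {scalar {poly C}}) (G : {poly C}) :
  (size G <= M)%N ->
  f G = \sum_(k < M) G.[w k] / (conodal k).[w k] * f (conodal k).
Proof.
move=> /conodal_interpolation {1}->; rewrite linear_sum.
by apply: eq_bigr => k _; rewrite linearZ.
Qed.

(** By interpolation the values on the [conodal k] determine F in degree < M. Beyond that,
    [nodal w * 'X^p] is monic of degree M + p, so once the lower moments vanish F sees only its
    leading term, and moment M + p of F equals moment p of f. *)
Lemma christoffel_orth (F f : {scalar {poly C}}) (a : nat) :
  (forall G, F (nodal w * G) = f G) -> (forall k, F (conodal k) = 0) ->
  (forall i, (i < a)%N -> f 'X^i = 0) ->
  (forall p, (p < M + a)%N -> F 'X^p = 0) /\ F 'X^(M + a) = f 'X^a.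
Proof.
move=> Ff F0 f0.
have step p : (forall i, (i < M + p)%N -> F 'X^i = 0) -> F 'X^(M + p) = f 'X^p.
  move=> Fp; rewrite -Ff (functional_graded (G := nodal w * 'X^p) Fp).
    rewrite coefMXn ltnNge leq_addl addnK /=.
    rewrite -[X in _`_X]/(M.+1.-1) -size_nodal -lead_coefE.
    by rewrite (monicP monic_nodal) mul1r.
  by rewrite size_mulXn ?nodal_neq0 // size_nodal; lia.
have low p : (p < M + a)%N -> F 'X^p = 0.
  elim/ltn_ind: p => p IH pa; case: (ltnP p M) => pM.
    rewrite functional_interpolation ?size_polyXn //.
    by rewrite big1 // => k _; rewrite F0 mulr0.
  rewrite -(subnKC pM) step ?f0 //; first lia.
  by move=> i ip; apply: IH; lia.
by split=> //; apply: step.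
Qed.

(* By interpolation, [F G] is minus the coefficient of degree M - 1 of [G * g]
   as soon as this product has degree < M. *)
Lemma conodal_moments (F : {scalar {poly C}}) (g : {poly C}) (p : nat) :
  (forall k, F (conodal k) = - g.[w k]) -> (size g + p <= M)%N -> (p < M)%N ->
  F 'X^p = - g`_(M.-1 - p).
Proof.
move=> Fg sg pM; rewrite functional_interpolation ?size_polyXn //.
have -> : g`_(M.-1 - p) = (g * 'X^p)`_M.-1.
  by rewrite coefMXn ifF //; lia.
rewrite coef_interpolation; last first.
  have [->|g0] := eqVneq g 0; first by rewrite mul0r size_poly0.
  by rewrite size_mulXn // addnC.
rewrite -sumrN; apply: eq_bigr => k _; rewrite Fg hornerM mulrN; congr (- _).
by rewrite mulrAC ['X^p.[_] * _]mulrC.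
Qed.

End Polynomials.

(** * Vectors of polynomials as coefficient rows, with the Hankel matrix acting on them *)

Section Pairing.
Variables (C : fieldType) (r : nat).
Local Notation pvec := {ffun 'I_r -> {poly C}}.
Implicit Types (mu : system C r) (n : multi r) (A P : pvec).

Definition pairing mu A (G : {poly C}) : C := \sum_(j < r) mu j (A j * G).

Lemma pairing_is_scalar mu A : scalar (pairing mu A).
Proof.
move=> a P Q; rewrite /pairing mulr_sumr -big_split; apply: eq_bigr => j _ /=.
by rewrite mulrDr -scalerAr linearP.
Qed.

HB.instance Definition _ mu A :=
  GRing.isLinear.Build C {poly C} C *%R (pairing mu A) (pairing_is_scalar mu A).

Lemma pairing_comb mu (I : finType) (c : I -> C) (V : I -> pvec) G :
  pairing mu (\sum_i c i *: V i) G = \sum_i c i * pairing mu (V i) G.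
Proof.
rewrite /pairing; under [RHS]eq_bigr do rewrite mulr_sumr.
rewrite exchange_big; apply: eq_bigr => j _ /=.
rewrite sum_ffunE mulr_suml linear_sum; apply: eq_bigr => i _ /=.
by rewrite ffunE -scalerAl linearZ.
Qed.

Lemma pairing_scale mu c A G : pairing mu (c *: A) G = c * pairing mu A G.
Proof.
rewrite /pairing mulr_sumr; apply: eq_bigr => j _.
by rewrite ffunE -scalerAl linearZ.
Qed.

(** The blocks follow the row blocks of [hankel], so that right multiplication by [hankel mu n]
    tabulates the first |n| moments of each vector. *)
Definition coefmx n (k : nat) (V : 'I_k -> pvec) : 'M[C]_(k, mlen n) :=
  \mxrow_(j < r) \matrix_(i < k, p < n j) (V i j)`_p.

Lemma mul_coefmx n k (V : 'I_k -> pvec) (u : 'rV[C]_k) :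
  u *m coefmx n V = coefmx n (fun _ : 'I_1 => \sum_i u 0 i *: V i).
Proof.
rewrite -[LHS]submxrowK; apply/eq_mxrowP => j.
rewrite -mul_submxrow /coefmx mxrowK; apply/matrixP => i p.
rewrite !mxE sum_ffunE coef_sum; apply: eq_bigr => l _.
by rewrite !mxE ffunE coefZ (ord1 i).
Qed.

Lemma coefmx_inj n P Q : typeI_deg n P -> typeI_deg n Q ->
  coefmx n (fun _ : 'I_1 => P) = coefmx n (fun _ : 'I_1 => Q) -> P = Q.
Proof.
move=> dP dQ; rewrite /coefmx => /eq_mxrowP PQ.
apply/ffunP => j; apply/polyP => p.
case: (ltnP p (n j)) => pn.
  by have /matrixP/(_ 0 (Ordinal pn)) := PQ j; rewrite !mxE.
by rewrite !nth_default // ?(leq_trans (dP j)) ?(leq_trans (dQ j)).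
Qed.

Lemma coefmx_hankel mu n k (V : 'I_k -> pvec) i q : typeI_deg n (V i) ->
  (coefmx n V *m hankel mu n) i q = pairing mu (V i) 'X^q.
Proof.
move=> dV; rewrite /coefmx /hankel mul_mxrow_mxcol summxE.
apply: eq_bigr => j _.
have -> : V i j = \poly_(p < n j) (V i j)`_p.
  apply/polyP => p; rewrite coef_poly; case: ltnP => // np.
  by rewrite nth_default // (leq_trans (dV j)).
rewrite poly_def mulr_suml linear_sum !mxE; apply: eq_bigr => p _ /=.
by rewrite !mxE -scalerAl linearZ /= -exprD.
Qed.

Lemma typeI_deg0 n : typeI_deg n (0 : pvec).
Proof. by move=> j; rewrite ffunE size_poly0. Qed.

Lemma coefmx_surj n (u : 'rV[C]_(mlen n)) :
  exists2 P, typeI_deg n P & coefmx n (fun _ : 'I_1 => P) = u.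
Proof.
(* [cf j p] is entry p of block j of [u]; the default 0 only makes it total, since the polynomial
   below reads p < n j. *)
pose cf j p :=
  if insub p is Some p' then (submxrow u j : 'rV_(n j)) 0 p' else 0.
exists [ffun j => \poly_(p < n j) cf j p].
  by move=> j; rewrite ffunE size_poly.
rewrite -[RHS]submxrowK; apply/eq_mxrowP => j; apply/matrixP => i p.
by rewrite mxE ffunE coef_poly ltn_ord (ord1 i) /cf valK.
Qed.

(** The rows annihilated by the Hankel matrix are the coefficient rows of the vectors with |n|
    vanishing moments. *)
Lemma normal_pairingP mu n :
  normal mu n <->
  (forall A, typeI_deg n A ->
     (forall p, (p < mlen n)%N -> pairing mu A 'X^p = 0) -> A = 0).
Proof.
split=> [nn A dA A0|H].
  apply: (coefmx_inj dA (@typeI_deg0 n)).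
  have Hu : hankel mu n \in unitmx by rewrite unitmxE unitfE.
  apply: (can_inj (mulmxK Hu)).
  apply/matrixP => i q.
  rewrite !coefmx_hankel ?A0 //; last exact: typeI_deg0.
  by rewrite /pairing big1 // => j _; rewrite ffunE mul0r linear0.
apply/det0P => -[v v0 vH]; have [P dP Pv] := coefmx_surj v.
case/eqP: v0; rewrite -Pv (H P dP).
  rewrite -(mul0mx 1 (coefmx n (fun _ : 'I_1 => 0))) mul_coefmx.
  apply/eq_mxrowP => j; apply/matrixP => i p; rewrite !mxE sum_ffunE !ffunE.
  by rewrite big1 // => l _; rewrite !ffunE scaler0.
move=> p pn.
have := coefmx_hankel mu (V := fun _ : 'I_1 => P) (i := 0) (Ordinal pn) dP.
by rewrite Pv vH mxE.
Qed.

(** A dimension count: the Hankel matrix is invertible, so vanishing of the first a moments cuts out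
    a space of dimension |n| - a = k, which k independent members must span. *)
Lemma span_of_free mu n k a (V : 'I_k -> pvec) P :
  normal mu n -> (k + a = mlen n)%N ->
  (forall i, typeI_deg n (V i)) ->
  (forall i p, (p < a)%N -> pairing mu (V i) 'X^p = 0) ->
  (forall c : 'I_k -> C, \sum_i c i *: V i = 0 -> forall i, c i = 0) ->
  typeI_deg n P -> (forall p, (p < a)%N -> pairing mu P 'X^p = 0) ->
  exists c : 'I_k -> C, P = \sum_i c i *: V i.
Proof.
move=> nn kaL dV oV free dP oP.
have dcomb (c : 'I_k -> C) : typeI_deg n (\sum_i c i *: V i).
  move=> j; rewrite sum_ffunE (leq_trans (size_sum _ _ _)) //.
  apply/bigmax_leqP => i _; rewrite ffunE (leq_trans (size_scale_leq _ _)) //.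
  exact: dV.
set W := coefmx n V.
have rW : row_free W.
  apply: inj_row_free => v; rewrite mul_coefmx => v0.
  apply/rowP => i; rewrite mxE; apply: (free (fun i => v 0 i)).
  apply: (coefmx_inj (dcomb _) (@typeI_deg0 n)); rewrite v0.
  by apply/esym/matrixP => i' p; rewrite /coefmx !mxE ffunE coef0.
(* [pid_mx a] keeps the first a columns, so [kermx K] consists of the coefficient rows whose first a
   moments vanish. *)
set K := hankel mu n *m (pid_mx a : 'M_(mlen n, a)).
have Hu : hankel mu n \in unitmx by rewrite unitmxE unitfE.
have rK : \rank K = a.
  by rewrite /K eqmxMfull ?row_full_unit // rank_pid_mx //; lia.
have ortK l (X : 'M_(l, mlen n)) :
    (forall i (q : 'I_(mlen n)), (q < a)%N -> X i q = 0) ->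
    X *m (pid_mx a : 'M_(mlen n, a)) = 0.
  move=> X0; apply/matrixP => i q; rewrite !mxE big1 // => p _; rewrite mxE.
  by case: (ltnP p a) => [/X0 ->|pa]; rewrite ?mul0r // andbF mulr0.
have WK : (W <= kermx K)%MS.
  apply/sub_kermxP; rewrite mulmxA; apply: ortK => i q qa.
  by rewrite coefmx_hankel ?oV.
have PK : (coefmx n (fun _ : 'I_1 => P) <= kermx K)%MS.
  apply/sub_kermxP; rewrite mulmxA; apply: ortK => i q qa.
  by rewrite coefmx_hankel ?oP.
have KW : (kermx K <= W)%MS.
  rewrite -(geq_leqif (mxrank_leqif_sup WK)) mxrank_ker rK (eqP rW); lia.
have /submxP[D] := submx_trans PK KW; rewrite mul_coefmx => PD.
exists (fun i => D 0 i); exact: (coefmx_inj dP (dcomb _) PD).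
Qed.

(** Take the largest i with [c i] non-zero: in component l the leading coefficient of [V i] cannot
    be cancelled by the earlier vectors. *)
Lemma free_of_sizes k (V : 'I_k -> pvec) (c : 'I_k -> C) :
  (forall i, exists2 l, V i l != 0 &
     forall i' : 'I_k, (i' < i)%N -> (size (V i' l) < size (V i l))%N) ->
  \sum_i c i *: V i = 0 -> forall i, c i = 0.
Proof.
move=> lead V0 i0; apply/eqP/negPn/negP => ci0.
case: (arg_maxnP (P := fun i => c i != 0) (fun i => val i) ci0) => i ci imax.
have [l Vil smaller] := lead i.
have /polyP/(_ (size (V i l)).-1) := congr1 (fun A : pvec => A l) V0.
rewrite sum_ffunE ffunE coef0 coef_sum (bigD1 i) //= ffunE coefZ -lead_coefE.
rewrite big1 ?addr0 => [/eqP|i' ii'].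
  by rewrite mulf_eq0 (negbTE ci) lead_coef_eq0 (negbTE Vil).
rewrite ffunE coefZ; have [->|ci'] := eqVneq (c i') 0; first by rewrite mul0r.
have ltii' : (i' < i)%N by rewrite ltn_neqAle ii'; apply: imax.
rewrite nth_default ?mulr0 // -ltnS (ltn_predK (smaller _ ltii')).
exact: smaller.
Qed.

End Pairing.

(** * Exact degrees of type I polynomials and independence along admissible sequences *)

Section Perfect.
Variables (C : fieldType) (r : nat) (mu : system C r) (hmu : perfect mu).
Local Notation pvec := {ffun 'I_r -> {poly C}}.
Variable A : multi r -> pvec.
Hypothesis hA : forall n, normalized_typeI mu n (A n).

Lemma mlen_eq0 (n : multi r) : (mlen n == 0%N) = (n == 0).
Proof.
rewrite /mlen sum_nat_eq0; apply/forallP/eqP => [H|->] /=.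
  by apply/ffunP => j; rewrite ffunE; apply/eqP/H.
by move=> j; rewrite ffunE.
Qed.

Lemma multiD (n m : multi r) j : (n + m) j = (n j + m j)%N.
Proof. by rewrite ffunE. Qed.

Lemma mlenD (n m : multi r) : mlen (n + m) = (mlen n + mlen m)%N.
Proof. by rewrite /mlen -big_split; apply: eq_bigr => j _; rewrite ffunE. Qed.

Lemma typeI_A n : n != 0 -> typeI mu n (A n).
Proof.
by move=> n0; have := hA n; rewrite /normalized_typeI (negbTE n0) => -[].
Qed.

Lemma deg_A n : typeI_deg n (A n).
Proof.
have [n0|/typeI_A[]//] := eqVneq n 0.
by have := hA n; rewrite /normalized_typeI n0 eqxx => ->; apply: typeI_deg0.
Qed.

Lemma orth_A n p : (p.+1 < mlen n)%N -> pairing mu (A n) 'X^p = 0.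
Proof.
have [->|/typeI_A[_ _ H]] := eqVneq n 0; last exact: H.
by have /eqP-> : mlen (0 : multi r) == 0%N by rewrite mlen_eq0.
Qed.

Lemma top_A n : n != 0 -> pairing mu (A n) 'X^((mlen n).-1) = 1.
Proof.
by move=> n0; have := hA n; rewrite /normalized_typeI (negbTE n0) => -[].
Qed.

(** If the degree dropped, [A n] would meet the degree bounds of n with component k lowered by one.
    Its |n| - 1 vanishing moments would then make it zero, by normality of that smaller index. *)
Lemma size_A (n : multi r) k : (0 < n k)%N -> size (A n k) = n k.
Proof.
move=> nk; apply/eqP; rewrite eqn_leq deg_A /= leqNgt; apply/negP => lt.
have n0 : n != 0 by apply: contraTneq nk => ->; rewrite ffunE.
have [An0 dA _] := typeI_A n0; apply: An0.
pose n' : multi r := [ffun j => (n j - (j == k))%N].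
have len : mlen n = (mlen n').+1.
  rewrite /mlen (bigD1 k) //= [in RHS](bigD1 k) //= ffunE eqxx -addSn.
  congr (_ + _)%N.
    by lia.
  by apply: eq_bigr => j /negbTE jk; rewrite ffunE jk subn0.
apply: (proj1 (normal_pairingP mu n')) => [|j|p pn]; first exact: hmu.
  rewrite ffunE; have [->|_] := eqVneq j k; last by rewrite subn0.
  by rewrite /=; lia.
by apply: orth_A; rewrite len.
Qed.

(** The component [k j] serves: its size at step j is exactly the index entry, while at earlier
    steps it is at most a strictly smaller entry. This is the input of [free_of_sizes]. *)
Lemma admissible_lead (m m' : multi r) s j : admissible m m' s ->
  (1 <= j <= mlen m' - mlen m)%N ->
  exists2 l, A (m + s j) l != 0 &
    forall i, (i < j)%N -> (size (A (m + s i)%R l) < size (A (m + s j)%R l))%N.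
Proof.
case=> _ _ _ [k hk] /andP[j0 jd]; exists (k j) => [|i ij].
  have s0j : (s 0%N (k j) < s j (k j))%N by apply: hk; rewrite j0.
  rewrite -size_poly_gt0 size_A multiD addn_gt0 (leq_ltn_trans _ s0j) ?orbT //.
have sij : (s i (k j) < s j (k j))%N by apply: hk; rewrite ij.
rewrite (@size_A (m + s j)) multiD; last first.
  by rewrite addn_gt0 (leq_ltn_trans _ sij) ?orbT.
by rewrite (leq_ltn_trans (deg_A _ _)) // multiD ltn_add2l.
Qed.

Lemma admissible_le (m m' : multi r) s j : admissible m m' s ->
  (j <= mlen m' - mlen m)%N -> mle (m + s j) m'.
Proof.
case=> mm' s0 le _ jd; case: (posnP j) => [->|j0].
  by rewrite s0 addr0.
by have [|] := le j; rewrite ?j0.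
Qed.

Lemma admissible_deg (m m' : multi r) s j : admissible m m' s ->
  (j <= mlen m' - mlen m)%N -> typeI_deg m' (A (m + s j)).
Proof.
by move=> adm jd l; apply: leq_trans (deg_A _ _) (admissible_le adm jd l).
Qed.

Lemma admissible_len (m m' : multi r) s j : admissible m m' s ->
  (1 <= j <= mlen m' - mlen m)%N -> (mlen m < mlen (m + s j)%R)%N.
Proof.
case=> _ _ _ [k hk] /andP[j0 jd]; rewrite mlenD -addn1 leq_add2l lt0n mlen_eq0.
have : (0 < s j (k j))%N by apply: leq_ltn_trans (hk 0%N j _); rewrite ?j0.
by apply: contraTneq => ->; rewrite ffunE.
Qed.

End Perfect.

(** * Expansion of a determinant along its top row *)

Section Cofactors.
Variables (C : comNzRingType) (q : nat) (E : 'M[C]_(q, 1 + q)).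

(** These cofactors do not involve the top row, which is therefore filled with zeros. *)
Definition top_cofactor (i : 'I_(1 + q)) : C :=
  cofactor (col_mx (0 : 'rV_(1 + q)) E) 0 i.

Lemma det_top_row (v : 'rV[C]_(1 + q)) :
  \det (col_mx v E) = \sum_i v 0 i * top_cofactor i.
Proof.
rewrite (expand_det_row _ 0); apply: eq_bigr => i _; congr (_ * _).
  by rewrite mxE; case: splitP => k; rewrite ?(ord1 k).
rewrite /top_cofactor /cofactor; congr (_ * \det _); apply/matrixP => a b.
rewrite !mxE; case: (splitP _) => k; rewrite ?lift0 // => ak.
by case: k ak => -[].
Qed.

(** Each entry of the product expands a determinant in which a row of [E] is repeated on top. *)
Lemma top_cofactor_ker : E *m (\col_i top_cofactor i) = 0.
Proof.
apply/matrixP => a b; rewrite !mxE.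
transitivity (\det (col_mx (row a E) E)).
  by rewrite det_top_row; apply: eq_bigr => i _; rewrite !mxE.
apply: (determinant_alternate (i1 := lshift q 0) (i2 := rshift 1 a)).
  by rewrite eq_lrshift.
by move=> i; rewrite col_mxEu col_mxEd mxE.
Qed.

Lemma top_cofactor0 : top_cofactor 0 = \det (\matrix_(a, b) E a (rshift 1 b)).
Proof.
rewrite /top_cofactor /cofactor expr0 mul1r; congr (\det _).
apply/matrixP => a b; rewrite !mxE; case: splitP => k; rewrite lift0 /=.
  by case: k => -[].
move=> [ak]; congr (E _ _); apply/val_inj => //=; rewrite lift0 //.
Qed.

End Cofactors.

(** The evaluation rows of [tilde_det] are constant polynomials; hence [tilde_det] is a combination
    of its top row with scalar coefficients. *)
Lemma top_cofactor_polyC (C : fieldType) q (E : 'M[C]_(q, 1 + q)) i :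
  top_cofactor (map_mx polyC E) i = (top_cofactor E i)%:P.
Proof.
by rewrite /top_cofactor -cofactor_map_mx map_col_mx map_mx0.
Qed.

(** * The kernel of the evaluation rows and its relation to the two determinants *)

Section Core.
Variables (C : fieldType) (r : nat).
Local Notation pvec := {ffun 'I_r -> {poly C}}.
Variables (N : multi r) (z : forall j : 'I_r, 'I_(N j) -> C) (M : nat).

Lemma eval_mx_ker q (A : 'I_q -> pvec) (B : 'I_q -> 'I_M -> C) (x : 'cV[C]_q) :
  eval_mx z A B *m x = 0 <->
  (forall j k, ((\sum_i x i 0 *: A i) j).[@z j k] = 0) /\
  (forall k, \sum_i x i 0 * B i k = 0).
Proof.
have -> : eval_mx z A B *m x =
    col_mx (\mxcol_(j < r) \col_(k < N j) ((\sum_i x i 0 *: A i) j).[@z j k])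
           (\col_k \sum_i x i 0 * B i k).
  rewrite /eval_mx mul_col_mx; congr col_mx; last first.
    by apply/colP => k; rewrite !mxE; apply: eq_bigr => i _; rewrite mxE mulrC.
  rewrite mxcol_mul; apply/eq_mxcolP => j; apply/colP => k; rewrite !mxE.
  rewrite sum_ffunE horner_sum; apply: eq_bigr => i _.
  by rewrite mxE ffunE hornerZ mulrC.
split=> [/eqP|[Z0 B0]].
  rewrite col_mx_eq0 => /andP[/eqP Z0 /eqP B0]; split=> [j k|k].
    move: Z0; rewrite -(mxcol0 (p_ := N) 1) => /eq_mxcolP/(_ j)/colP/(_ k).
    by rewrite !mxE.
  by move/colP: B0 => /(_ k); rewrite !mxE.
apply/eqP; rewrite col_mx_eq0; apply/andP; split; apply/eqP.
  rewrite -(mxcol0 (p_ := N) 1); apply/eq_mxcolP => j; apply/colP => k.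
  by rewrite !mxE.
by apply/colP => k; rewrite !mxE.
Qed.

Variables (Ac : nat -> pvec) (Bc : nat -> 'I_M -> C).
Local Notation q := (mlen N + M)%N.

Definition comb (c : nat -> C) : pvec := \sum_(i < 1 + q) c i *: Ac i.

Definition in_kernel (c : nat -> C) : Prop :=
  (forall j k, (comb c j).[@z j k] = 0) /\
  (forall k, \sum_(i < 1 + q) c i * Bc i k = 0).

(** The coefficients are the top cofactors; the one of column 0 is the minor [DI]. *)
Lemma tilde_det_comb : exists2 c, in_kernel c &
  c 0%N = DI z Ac Bc /\ forall j, tilde_det z Ac Bc j = comb c j.
Proof.
set E := eval_mx z (fun i : 'I_(1 + q) => Ac i) (fun i : 'I_(1 + q) => Bc i).
pose c i : C := top_cofactor E (inord i).
have cE (i : 'I_(1 + q)) : c i = top_cofactor E i by rewrite /c inord_val.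
exists c; last split.
- have /eval_mx_ker[Z0 B0] := top_cofactor_ker E; split=> [j k|k].
    rewrite -[RHS](Z0 j k) /comb; congr ((_ : pvec) j).[_].
    by apply: eq_bigr => i _; rewrite mxE cE.
  by rewrite -[RHS](B0 k); apply: eq_bigr => i _; rewrite mxE cE.
- rewrite (cE 0) top_cofactor0; congr (\det _); apply/matrixP => a b.
  rewrite /E /eval_mx !mxE; case: (split a) => a'; rewrite !mxE //.
- move=> j; rewrite /tilde_det det_top_row /comb sum_ffunE.
  apply: eq_bigr => i _.
  by rewrite mxE top_cofactor_polyC ffunE -mul_polyC mulrC cE.
Qed.

(** Kernel vectors with [c 0 = 0] are, after a shift of the index by one, the kernel of the square
    matrix formed by columns 1 to q. *)
Lemma DI_kernel : DI z Ac Bc != 0 <->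
  forall c, in_kernel c -> c 0%N = 0 -> forall i, (i < 1 + q)%N -> c i = 0.
Proof.
set E := eval_mx z (fun i : 'I_q => Ac i.+1) (fun i : 'I_q => Bc i.+1).
have kerE (c : nat -> C) : c 0%N = 0 ->
    in_kernel c <-> E *m (\col_(i < q) c i.+1) = 0.
  move=> c0.
  have combE : comb c = \sum_(i < q) (\col_(i < q) c i.+1) i 0 *: Ac i.+1.
    rewrite /comb big_ord_recl c0 scale0r add0r.
    by apply: eq_bigr => i _; rewrite mxE.
  have BcE k : \sum_(i < 1 + q) c i * Bc i k =
               \sum_(i < q) (\col_(i < q) c i.+1) i 0 * Bc i.+1 k.
    rewrite big_ord_recl c0 mul0r add0r.
    by apply: eq_bigr => i _; rewrite mxE.
  rewrite eval_mx_ker /in_kernel combE.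
  by split=> -[Z0 B0]; split=> // k; rewrite ?BcE // -BcE.
rewrite /DI -/E; split=> [D0 c kc c0 i iq|H].
  case: i iq => [|i] iq //.
  have Eu : E \in unitmx by rewrite unitmxE unitfE.
  have /colP/(_ (Ordinal (iq : (i < q)%N))) : \col_(i < q) c i.+1 = 0.
    apply: (can_inj (mulKmx Eu)); rewrite mulmx0; exact/kerE.
  by rewrite !mxE.
(* [det0P] yields row vectors, so the matrix is transposed to reach its column kernel. *)
rewrite -det_tr; apply/det0P => -[v v0 vE]; case/eqP: v0; apply/rowP => i.
pose c l := if l is l'.+1 then
  (if insub l' is Some l'' then v 0 (l'' : 'I_q) else 0) else 0.
have cv (l : 'I_q) : c l.+1 = v 0 l by rewrite /c valK.
rewrite -cv mxE; apply: H => //; last by rewrite ltnS.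
apply/kerE => //; apply: trmx_inj; rewrite trmx_mul trmx0 -[RHS]vE.
by congr (_ *m _); apply/rowP => l; rewrite !mxE cv.
Qed.

End Core.

(** * The conclusions, deduced from a bijection between the kernel and type I vectors *)

Section Parametrization.
Variables (C : fieldType) (r : nat).
Local Notation pvec := {ffun 'I_r -> {poly C}}.
Variables (N : multi r) (z : forall j : 'I_r, 'I_(N j) -> C) (M : nat).
Hypothesis z_inj : forall j, injective (@z j).
Variables (mut : system C r) (n : multi r) (n0 : n != 0).
Variables (Ac : nat -> pvec) (Bc : nat -> 'I_M -> C).
Local Notation q := (mlen N + M)%N.
Local Notation comb := (comb N M Ac).
Local Notation in_kernel := (in_kernel z Ac Bc).

(** The sign relating the moment of degree |n| - 1 to [c 0]: it is 1 when |n| > M and -1 when |n| <=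
    M. *)
Variable sigma : C.
Hypothesis sigma0 : sigma != 0.
Hypothesis deg_Ac : forall i, (i < 1 + q)%N -> typeI_deg (n + N) (Ac i).
Hypothesis kernel_orth : forall c (Q : pvec), in_kernel c ->
  (forall j, comb c j = nodal (@z j) * Q j) ->
  typeI_orth mut n Q /\ pairing mut Q 'X^((mlen n).-1) = sigma * c 0%N.
Hypothesis kernel_free : forall c, in_kernel c -> comb c = 0 ->
  forall i, (i < 1 + q)%N -> c i = 0.
Hypothesis kernel_full : forall Q : pvec, typeI_deg n Q -> typeI_orth mut n Q ->
  exists2 c, in_kernel c & forall j, comb c j = nodal (@z j) * Q j.

Lemma comb_quotient c : in_kernel c ->
  exists Q : pvec, typeI_deg n Q /\ forall j, comb c j = nodal (@z j) * Q j.
Proof.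
case=> Z0 _.
have dvd j : nodal (@z j) %| comb c j by apply: nodal_dvdp.
exists [ffun j => comb c j %/ nodal (@z j)]; split=> j; rewrite ffunE.
  rewrite size_divp ?nodal_neq0 // size_nodal /= leq_subLR addnC -multiD.
  rewrite /comb sum_ffunE (leq_trans (size_sum _ _ _)) //.
  apply/bigmax_leqP => i _; rewrite ffunE (leq_trans (size_scale_leq _ _)) //.
  exact: deg_Ac.
by rewrite mulrC divpK.
Qed.

(** Both sides assert that a kernel is trivial. The correspondence between c and Q matches them,
    because the one further moment required to vanish is [sigma * c 0]. *)
Lemma normal_tilde : normal mut n <-> DI z Ac Bc != 0.
Proof.
have len0 : (0 < mlen n)%N by rewrite lt0n mlen_eq0.
rewrite normal_pairingP DI_kernel; split=> [nn c kc c0|H Q dQ Q0].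
  have [Q [dQ cQ]] := comb_quotient kc; apply: kernel_free => //.
  have [oQ topQ] := kernel_orth kc cQ.
  suff Q0 : Q = 0 by apply/ffunP => j; rewrite cQ Q0 !ffunE mulr0.
  apply: nn => // p pn; have [lt|ge] := ltnP p.+1 (mlen n); first exact: oQ.
  have -> : p = (mlen n).-1 by lia.
  by rewrite topQ c0 mulr0.
have oQ : typeI_orth mut n Q by move=> p pn; apply: Q0; apply: ltnW.
have [c kc cQ] := kernel_full dQ oQ.
have [_ topQ] := kernel_orth kc cQ.
have c0 : c 0%N = 0.
  have := Q0 (mlen n).-1; rewrite topQ ltn_predL => /(_ len0)/eqP.
  by rewrite mulf_eq0 (negbTE sigma0) => /eqP.
apply/ffunP => j; apply/eqP; rewrite ffunE.
rewrite -(mulrI_eq0 _ (lregP (nodal_neq0 (@z j)))) -cQ.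
rewrite /comb sum_ffunE big1 // => i _; rewrite ffunE.
by rewrite (H c kc c0 i) ?scale0r.
Qed.

(** The tilde vector is the quotient Q of the cofactor vector, for which [c 0 = D]; its top moment
    is thus [sigma * D]. *)
Lemma tilde_vecP :
  let At := tilde_vec z Ac Bc in
  let D := DI z Ac Bc in
  [/\ forall j : 'I_r, nodal (@z j) %| tilde_det z Ac Bc j,
      typeI_orth mut n At, typeI_deg n At, normal mut n <-> D != 0
    & D != 0 -> normalized_typeI mut n (pvec_scale (sigma * D)^-1 At)].
Proof.
move=> At D; have [c kc [c0 cE]] := tilde_det_comb z Ac Bc.
have [Q [dQ cQ]] := comb_quotient kc.
have -> : At = Q.
  apply/ffunP => j; rewrite ffunE cE cQ mulrC mulpK //; exact: nodal_neq0.
have [oQ topQ] := kernel_orth kc cQ.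
split=> //; first by move=> j; rewrite cE cQ dvdp_mulr.
  exact: normal_tilde.
move=> D0; rewrite /normalized_typeI (negbTE n0).
have -> : pvec_scale (sigma * D)^-1 Q = (sigma * D)^-1 *: Q.
  by apply/ffunP => j; rewrite !ffunE.
have top1 : pairing mut ((sigma * D)^-1 *: Q) 'X^((mlen n).-1) = 1.
  by rewrite pairing_scale topQ c0 mulVf // mulf_neq0.
split=> //; split.
- move=> Q0; move: top1; rewrite Q0 -(scale0r 0) pairing_scale mul0r.
  by move/esym/eqP; rewrite oner_eq0.
- move=> j; rewrite ffunE (leq_trans (size_scale_leq _ _)) //; exact: dQ.
- by move=> p pn; rewrite -/(pairing _ _ _) pairing_scale /pairing oQ ?mulr0.
Qed.

End Parametrization.

(** * Transfer between [mu], [mut] and [chk] *)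

Section Christoffel.
Variables (C : fieldType) (r : nat).
Local Notation pvec := {ffun 'I_r -> {poly C}}.
Variables (mu : system C r) (hmu : perfect mu).
Variables (N : multi r) (z : forall j : 'I_r, 'I_(N j) -> C).
Hypothesis z_inj : forall j, injective (@z j).
Variables (M : nat) (w : 'I_M -> C).
Hypothesis w_inj : injective w.
Variables mut chk : system C r.
Hypothesis hmut : forall j,
  pmulf (nodal w) (mut j) =1 pmulf (nodal (@z j)) (mu j).
Hypothesis hchk : forall j, pmulf (nodal (@z j)) (chk j) =1 mut j.
Variable A : multi r -> pvec.
Hypothesis hA : forall n, normalized_typeI mu n (A n).

Lemma pairing_mut (P Q : pvec) (G : {poly C}) :
  (forall j, P j = nodal (@z j) * Q j) ->
  pairing mut Q (nodal w * G) = pairing mu P G.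
Proof.
move=> PQ; apply: eq_bigr => j _; rewrite PQ mulrCA -[in RHS]mulrA.
exact: (hmut j (Q j * G)).
Qed.

(** With G = [conodal w k] this turns the B-values of P into values of the functional of Q. *)
Lemma pairing_chk (P Q : pvec) (G : {poly C}) :
  (forall j, P j = nodal (@z j) * Q j) ->
  pairing chk P G = pairing mut Q G.
Proof.
move=> PQ; apply: eq_bigr => j _; rewrite PQ -mulrA.
exact: (hchk j (Q j * G)).
Qed.

Lemma deg_nodal_mul (n : multi r) (P Q : pvec) :
  (forall j, P j = nodal (@z j) * Q j) -> typeI_deg n Q -> typeI_deg (n + N) P.
Proof.
move=> PQ dQ j; rewrite PQ multiD; have [->|Q0] := eqVneq (Q j) 0.
  by rewrite mulr0 size_poly0.
rewrite size_monicM ?monic_nodal // size_nodal /= addnC leq_add2r; exact: dQ.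
Qed.

Local Notation q := (mlen N + M)%N.

(** * The case |n| > M *)

Section Large.
Variables (n m : multi r) (s : nat -> multi r).
Hypotheses (Mn : (M < mlen n)%N) (lenm : mlen m = (mlen n - M)%N).
Hypothesis adm : admissible m (n + N) s.
Let Ac i := A (m + s i).
Let Bc i := Bval chk w (A (m + s i)).

Let steps : (mlen (n + N)%R - mlen m)%N = q.
Proof. by rewrite mlenD lenm; lia. Qed.

Let m0 : m != 0.
Proof. by rewrite -mlen_eq0 lenm; lia. Qed.

Let n0 : n != 0.
Proof. by rewrite -mlen_eq0; lia. Qed.

Let AcE0 : Ac 0%N = A m.
Proof. by case: adm => _ s0 _ _; rewrite /Ac s0 addr0. Qed.

Let orth_Ac i p : (i < 1 + q)%N -> (p < (mlen m).-1)%N ->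
  pairing mu (Ac i) 'X^p = 0.
Proof.
move=> iq pm; apply: (orth_A hA); case: i iq => [|i] iq.
  by case: adm => _ -> _ _; rewrite addr0; lia.
have := @admissible_len _ _ _ _ i.+1 adm; rewrite steps => /(_ iq); lia.
Qed.

(** Indices after the first are longer than m, so their orthogonality reaches degree |m| - 1; only
    column 0 contributes to this moment. *)
Let top_Ac i : (i < 1 + q)%N ->
  pairing mu (Ac i) 'X^((mlen m).-1) = (i == 0%N)%:R.
Proof.
case: i => [|i] iq; first by rewrite AcE0 top_A.
apply: (orth_A hA); have := @admissible_len _ _ _ _ i.+1 adm.
rewrite steps => /(_ iq); have : (0 < mlen m)%N by rewrite lt0n mlen_eq0.
lia.
Qed.

Let free_Ac (c : 'I_(1 + q) -> C) : \sum_i c i *: Ac i = 0 -> forall i, c i = 0.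
Proof.
apply: free_of_sizes => -[[|i] iq] /=.
  (* Column 0 has no predecessor, so any non-zero component will do. *)
  have [Am0 _ _] := typeI_A hA m0.
  have [l Aml] : exists l, A m l != 0.
    apply/existsP; apply: contra_notT Am0; rewrite negb_exists => /forallP Z.
    by apply/ffunP => l; rewrite ffunE; apply/eqP/negPn/Z.
  by exists l; rewrite ?AcE0.
have [|l Al lt] := admissible_lead (j := i.+1) hmu hA adm.
  by rewrite steps.
by exists l => // i' i'i; apply: lt.
Qed.

Let kernel_B c (Q : pvec) k : in_kernel z Ac Bc c ->
  (forall j, comb N M Ac c j = nodal (@z j) * Q j) ->
  pairing mut Q (conodal w k) = 0.
Proof.
move=> [_ B0] cQ; rewrite -(pairing_chk _ cQ) /comb pairing_comb.
exact: B0.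
Qed.

Lemma tilde_large :
  let At := tilde_vec z Ac Bc in
  let D := DI z Ac Bc in
  [/\ forall j : 'I_r, nodal (@z j) %| tilde_det z Ac Bc j,
      typeI_orth mut n At, typeI_deg n At, normal mut n <-> D != 0
    & D != 0 -> normalized_typeI mut n (pvec_scale D^-1 At)].
Proof.
have len_m : (0 < mlen m)%N by rewrite lt0n mlen_eq0.
rewrite /= -[X in X^-1]mul1r; apply: tilde_vecP => //; first exact: oner_neq0.
- by move=> i iq; apply: (admissible_deg hA adm); rewrite steps.
- move=> c Q kc cQ.
  (* Here a = |m| - 1, so that M + a = |n| - 1. *)
  have [|||low top] := @christoffel_orth _ _ w w_inj (pairing mut Q)
    (pairing mu (comb N M Ac c)) (mlen m).-1.
  + by move=> G; apply: pairing_mut.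
  + by move=> k; apply: kernel_B kc cQ.
  + move=> p pm; rewrite /= /comb pairing_comb big1 // => i _.
    by rewrite orth_Ac ?mulr0.
  split; first by move=> p pn; apply: low; lia.
  have -> : (mlen n).-1 = (M + (mlen m).-1)%N by lia.
  rewrite top /= /comb pairing_comb big_ord_recl top_Ac // mulr1 mul1r.
  by rewrite big1 ?addr0 //; move=> i _; rewrite top_Ac // mulr0.
- by move=> c _ /(free_Ac (c := fun i => c i)) c0 i iq; apply: (c0 (Ordinal iq)).
move=> Q dQ oQ; pose P : pvec := [ffun j => nodal (@z j) * Q j].
have PQ j : P j = nodal (@z j) * Q j by rewrite ffunE.
have lowQ (G : {poly C}) : (size G < mlen n)%N -> pairing mut Q G = 0.
  move=> sG; apply: (functional_eq0 (a := (mlen n).-1)); last by lia.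
  by move=> p pn; apply: oQ; lia.
(* The count is (1 + q) + (|m| - 1) = |n + N|. *)
have [||||||c Pc] := @span_of_free _ _ mu (n + N) (1 + q) (mlen m).-1
  (fun i => Ac i) P (hmu _).
- by rewrite -steps; have := admissible_le adm (leq0n _); rewrite mlenD; lia.
- by move=> i; apply: (admissible_deg hA adm); rewrite steps -ltnS.
- by move=> i p; apply: orth_Ac.
- exact: free_Ac.
- exact: deg_nodal_mul PQ dQ.
- move=> p pm; rewrite -(pairing_mut _ PQ); apply: lowQ.
  by rewrite size_mulXn ?nodal_neq0 // size_nodal; lia.
have combP : comb N M Ac (fun i => c (inord i)) = P.
  by rewrite Pc; apply: eq_bigr => i _; rewrite inord_val.
exists (fun i => c (inord i)); last by move=> j; rewrite combP.
split=> [j k|k].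
  by rewrite combP PQ hornerM horner_nodal mul0r.
(* The B-values vanish because [conodal w k] has size M < |n|. *)
rewrite -[RHS](lowQ (conodal w k)) ?size_conodal // -(pairing_chk _ PQ) -combP.
by rewrite /comb pairing_comb.
Qed.

End Large.

(** * The case 0 < |n| <= M *)

Section Small.
Variables (n : multi r) (t : nat -> multi r).
Hypothesis lenn : (0 < mlen n <= M)%N.
Hypothesis adm : admissible 0 (n + N) t.
Local Notation e := (M - mlen n)%N.
Local Notation L := (mlen (n + N)).
Let ms i := 0 + t (i - e)%N.
Let Ac i := if (i <= e)%N then 0 else A (ms i).
Let Bc i k := if (i <= e)%N then w k ^+ (e - i) else Bval chk w (A (ms i)) k.
Let V (l : nat) := A (0 + t l.+1).

Let n0 : n != 0.
Proof. by rewrite -mlen_eq0; lia. Qed.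

Let mlen0 : mlen (0 : multi r) = 0%N.
Proof. by apply/eqP; rewrite mlen_eq0. Qed.

Let sum_split (U : zmodType) (F : nat -> U) :
  \sum_(i < 1 + q) F i = \sum_(i < e.+1) F i + \sum_(l < L) F (e.+1 + l)%N.
Proof.
have -> : (1 + q = e.+1 + L)%N by rewrite mlenD; lia.
by rewrite big_split_ord.
Qed.

Let tail (l : nat) : ((e.+1 + l <= e)%N = false) * ((e.+1 + l - e)%N = l.+1).
Proof. by split; lia. Qed.

Let comb_V (c : nat -> C) : comb N M Ac c = \sum_(l < L) c (e.+1 + l)%N *: V l.
Proof.
rewrite /comb (sum_split (fun i => c i *: Ac i)) big1 ?add0r => [|i _].
  by apply: eq_bigr => l _; rewrite /Ac /ms !tail.
by rewrite /Ac -ltnS ltn_ord scaler0.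
Qed.

(** The polynomial whose values at the nodes come from the monomial columns. Column i carries the
    power e - i, so the order is reversed and the coefficient of degree e is [c 0]. *)
Let head c : {poly C} := \poly_(l < e.+1) c (e - l)%N.

Let size_head c : (size (head c) <= e.+1)%N.
Proof. exact: size_poly. Qed.

Let sum_Bc (c : nat -> C) k : \sum_(i < 1 + q) c i * Bc i k =
  (head c).[w k] + pairing chk (comb N M Ac c) (conodal w k).
Proof.
rewrite (sum_split (fun i => c i * Bc i k)) comb_V pairing_comb; congr (_ + _).
  rewrite horner_poly [RHS](reindex_inj rev_ord_inj); apply: eq_bigr => i _ /=.
  by rewrite /Bc -ltnS ltn_ord subSS subKn // -ltnS.
by apply: eq_bigr => l _; rewrite /Bc /ms !tail.
Qed.

Let free_V (c : 'I_L -> C) : \sum_l c l *: V l = 0 -> forall l, c l = 0.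
Proof.
apply: free_of_sizes => l.
have [|l' Al lt] := admissible_lead (j := l.+1) hmu hA adm.
  by rewrite mlen0 subn0 ltn_ord.
by exists l' => // i il; apply: lt.
Qed.

Lemma tilde_small :
  let At := tilde_vec z Ac Bc in
  let D := DI z Ac Bc in
  [/\ forall j : 'I_r, nodal (@z j) %| tilde_det z Ac Bc j,
      typeI_orth mut n At, typeI_deg n At, normal mut n <-> D != 0
    & D != 0 -> normalized_typeI mut n (pvec_scale (- D^-1) At)].
Proof.
have degV l : (l < L)%N -> typeI_deg (n + N) (V l).
  by move=> lL; apply: (admissible_deg hA adm); rewrite mlen0 subn0.
(* The factor is put in the form [(sigma * D)^-1] with sigma = -1. *)
rewrite /= -invrN -[X in X^-1]mulN1r; apply: tilde_vecP => //.
- by rewrite oppr_eq0 oner_neq0.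
- move=> i iq; rewrite /Ac; case: leqP => ie; first exact: typeI_deg0.
  by apply: (admissible_deg hA adm); rewrite mlen0 mlenD; lia.
- move=> c Q [_ B0] cQ.
  have Fg k : pairing mut Q (conodal w k) = - (head c).[w k].
    apply/eqP; rewrite -(pairing_chk _ cQ) -addr_eq0 addrC -sum_Bc; exact/eqP.
  (* For p <= |n| - 2 the coefficient index exceeds e, giving 0; for p = |n| - 1 it equals e, giving
     - [c 0]. *)
  have mom p : (p < mlen n)%N -> pairing mut Q 'X^p = - (head c)`_(M.-1 - p).
    move=> pn; apply: (conodal_moments w_inj Fg); last by lia.
    by have := size_head c; lia.
  split=> [p pn|].
    rewrite -/(pairing _ _ _) mom ?nth_default ?oppr0 //; last exact: ltnW.
    by rewrite (leq_trans (size_head c)) //; lia.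
  rewrite mom ?ltn_predL; last by case/andP: lenn.
  have -> : (M.-1 - (mlen n).-1 = e)%N by lia.
  by rewrite coef_poly ltnSn subnn mulN1r.
- move=> c [_ B0] c0.
  have tl0 l : (l < L)%N -> c (e.+1 + l)%N = 0.
    move=> lL; move: c0; rewrite comb_V => /free_V cl; exact: (cl (Ordinal lL)).
  (* With the tail gone, [head c] has size at most e + 1 <= M and vanishes at the M nodes. *)
  have hd0 : head c = 0.
    apply: (eq0_of_nodes w_inj) => [|k]; first by have := size_head c; lia.
    have := B0 k; rewrite sum_Bc c0 => <-; rewrite /pairing big1 ?addr0 // => j _.
    by rewrite ffunE mul0r linear0.
  move=> i iq; case: (leqP i e) => ie; last first.
    have -> : i = (e.+1 + (i - e.+1))%N by lia.
    by apply: tl0; rewrite mlenD; lia.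
  have /polyP/(_ (e - i)%N) := hd0.
  by rewrite coef_poly coef0 subKn // ltnS leq_subr.
move=> Q dQ oQ; pose P : pvec := [ffun j => nodal (@z j) * Q j].
have PQ j : P j = nodal (@z j) * Q j by rewrite ffunE.
(* With a = 0 the L = |n + N| free vectors span all vectors within the degree bounds of n + N. *)
have [||||||b Pb] := @span_of_free _ _ mu (n + N) L 0 (fun l => V l) P (hmu _).
- exact: addn0.
- by move=> l; apply: degV.
- by [].
- exact: free_V.
- exact: deg_nodal_mul PQ dQ.
- by [].
(* The Lagrange interpolant of the values that the kernel equations force on [head c]. *)
pose g : {poly C} :=
  \sum_(k < M) (- pairing mut Q (conodal w k) / (conodal w k).[w k])
    *: conodal w k.
have gw k : g.[w k] = - pairing mut Q (conodal w k) by rewrite horner_conodal_sum.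
have sgM : (size g <= M)%N by rewrite /g size_conodal_sum.
have sg : (size g <= e.+1)%N.
  (* Were g larger, p = M - size g would be at most |n| - 2, and the vanishing moment of degree p
     would be minus the leading coefficient of g. *)
  rewrite leqNgt; apply/negP => sg.
  have : pairing mut Q 'X^(M - size g) = 0 by apply: oQ; lia.
  rewrite (conodal_moments (g := g) w_inj) => [|k||]; try lia.
    have -> : (M.-1 - (M - size g) = (size g).-1)%N by lia.
    move/eqP; rewrite oppr_eq0 -lead_coefE lead_coef_eq0 => /eqP g0.
    by move: sg; rewrite g0 size_poly0.
  by rewrite gw opprK.
(* The coefficients of g in reverse order, followed by the coordinates [b] of P. *)
pose c i := if (i <= e)%N then g`_(e - i)
            else if insub (i - e.+1)%N is Some l then b l else 0.
have cV (l : 'I_L) : c (e.+1 + l)%N = b l by rewrite /c tail addKn valK.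
have combP : comb N M Ac c = P.
  by rewrite comb_V Pb; apply: eq_bigr => l _; rewrite cV.
have headg : head c = g.
  apply/polyP => l; rewrite coef_poly ltnS /c leq_subr; case: leqP => le.
    by rewrite subKn.
  by rewrite nth_default // (leq_trans sg).
exists c; last by move=> j; rewrite combP.
split=> [j k|k].
  by rewrite combP PQ hornerM horner_nodal mul0r.
by rewrite sum_Bc headg gw combP (pairing_chk _ PQ) addNr.
Qed.

End Small.

End Christoffel.

Theorem theorem3p1 (R : realType) (r : nat) (hr : (1 <= r)%N)
    (mu : system R[i] r) (hmu : perfect mu)
    (N : multi r) (z : forall j : 'I_r, 'I_(N j) -> R[i])
    (hz : forall j : 'I_r, injective (z j))
    (M : nat) (w : 'I_M -> R[i]) (hw : injective w)
    (mut : system R[i] r)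
    (hmut : forall j : 'I_r, pmulf (nodal w) (mut j) =1 pmulf (nodal (z j)) (mu j))
    (chk : system R[i] r)
    (hchk : forall j : 'I_r, pmulf (nodal (z j)) (chk j) =1 mut j)
    (A : multi r -> {ffun 'I_r -> {poly R[i]}})
    (hA : forall n : multi r, normalized_typeI mu n (A n)) :
  [/\ (* (1) *)
      forall (n m : multi r) (s : nat -> multi r),
        (M < mlen n)%N ->
        mlen m = (mlen n - M)%N ->
        mle m (n + N) ->
        admissible m (n + N) s ->
        let Ac i := A (m + s i) in
        let Bc i := Bval chk w (A (m + s i)) in
        let At := tilde_vec z Ac Bc in
        let D := DI z Ac Bc in
        [/\ forall j : 'I_r, nodal (z j) %| tilde_det z Ac Bc j,
            typeI_orth mut n At,
            typeI_deg n At,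
            normal mut n <-> D != 0
          & D != 0 -> normalized_typeI mut n (pvec_scale D^-1 At)],
      (* (2) *)
      forall (n : multi r) (t : nat -> multi r),
        (0 < mlen n <= M)%N ->
        admissible 0 (n + N) t ->
        (* the index labelled m + s_i, for i >= M - |n| *)
        let ms i := 0 + t (i - (M - mlen n))%N in
        let Ac i := if (i <= M - mlen n)%N then 0 else A (ms i) in
        let Bc i k := if (i <= M - mlen n)%N then w k ^+ (M - mlen n - i)
                      else Bval chk w (A (ms i)) k in
        let At := tilde_vec z Ac Bc in
        let D := DI z Ac Bc in
        [/\ forall j : 'I_r, nodal (z j) %| tilde_det z Ac Bc j,
            typeI_orth mut n At,
            typeI_deg n At,
            normal mut n <-> D != 0
          & (* with the B-values w_k^(M-|n|-i) the functional of At at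
               x^(|n|-1) is - D, so the normalizing factor is - 1 / D *)
            D != 0 -> normalized_typeI mut n (pvec_scale (- D^-1) At)]
    & (* (3) *)
      forall n : multi r, n = 0 ->
        normalized_typeI mut n 0 /\
        forall At : {ffun 'I_r -> {poly R[i]}}, typeI_deg n At -> typeI_orth mut n At -> At = 0].
Proof.
split=> [n m s Mn lenm _ adm|n t lenn adm|n ->].
- exact: (tilde_large hmu hz hw hmut hchk hA Mn lenm adm).
- exact: (tilde_small hmu hz hw hchk hA lenn adm).
split=> [|At dA _]; first by rewrite /normalized_typeI eqxx.
apply/ffunP => j; apply/eqP; rewrite ffunE -size_poly_leq0.
by have := dA j; rewrite ffunE.
Qed.
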